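(* Fix a state $s\in\mathcal{S}$, a task vector $z\in\mathbb{R}^d$, a behavior policy density $\mu(\cdot|s)$ on the action space $\mathcal{A}$, a representation $F:\mathcal{S}\times\mathcal{A}\times\mathbb{R}^d\to\mathbb{R}^d$, the associated fixed state-value $V(s,z)$ (defined in the context), and $\epsilon>0$. Consider the constrained optimization problem over policies (conditional densities) $\pi_z(\cdot|s)$: $$\max_{\pi_z}\ \mathbb{E}_{a\sim\pi_z(\cdot|s)}\left[F(s,a,z)^\top z-V(s,z)\right]\quad\text{subject to}\quad \int_{\mathcal{A}}\pi_z(a|s)\,da=1,\qquad D_{\mathrm{KL}}\big(\pi_z(\cdot|s)\,\|\,\mu(\cdot|s)\big)\le\epsilon .$$ Let $\pi_z^*$ be a solution of this problem and let $1/\alpha$, with $\alpha>0$, be the Lagrange multiplier for the KL constraint. Then $$\pi_z^*(a|s)\ \propto\ \mu(a|s)\,\exp\!\left(\alpha\cdot\left(F(s,a,z)^\top z-V(s,z)\right)\right),$$ where $\propto$ means equality as functions of $a$ (almost everywhere) up to a positive normalization factor depending only on $s$ and $z$.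
   Context: $\mathcal{S}$ is a state space, $\mathcal{A}\subset\mathbb{R}^m$ is an action space, and policies are identified with their probability densities $\pi(\cdot|s)$ with respect to Lebesgue measure $da$ on $\mathcal{A}$. $\mu(a|s)$ is the density of the (unknown) behavior policy that generated the offline dataset. $F(s,a,z)^\top z$ plays the role of the action-value function $Q_z(s,a)$ for task $z$. The state-value is $$V(s,z):=\max_{a\in\mathcal{A}:\ \mu(a|s)>0}F(s,a,z)^\top z$$ (written $V_{\pi_z}(s,z)$ in the source); the maximum is assumed to exist, and $F$ and $V$ are given and held fixed, so they do not vary with the optimization variable $\pi_z$. $D_{\mathrm{KL}}(p\|q)=\int p\log(p/q)$, equal to $+\infty$ if $p$ is not absolutely continuous with respect to $q$. ''$\lambda\ge 0$ is the Lagrange multiplier for the KL constraint'' is understood in the usual convex-duality sense: the solution $\pi_z^*(\cdot|s)$ maximizes, over all probability densities $\pi(\cdot|s)$ on $\mathcal{A}$ with finite KL divergence to $\mu(\cdot|s)$, the functional $\mathbb{E}_{a\sim\pi(\cdot|s)}[F(s,a,z)^\top z-V(s,z)]-\lambda\left(D_{\mathrm{KL}}(\pi(\cdot|s)\|\mu(\cdot|s))-\epsilon\right)$, together with the complementary slackness condition $\lambda\left(D_{\mathrm{KL}}(\pi_z^*(\cdot|s)\|\mu(\cdot|s))-\epsilon\right)=0$. Here $\lambda=1/\alpha$. *)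

(* Defs.v *)
From HB Require Import structures.
From mathcomp Require Import all_boot all_order all_algebra.
From mathcomp Require Import all_classical all_reals all_analysis.

Set Implicit Arguments.
Unset Strict Implicit.
Unset Printing Implicit Defensive.

Import Order.TTheory GRing.Theory Num.Theory.
Import numFieldNormedType.Exports.

Local Open Scope classical_set_scope.
Local Open Scope ring_scope.

(* MathComp-Analysis has no Lebesgue measure on R^m. Points of R^m are encoded
   as m.-tuple R, whose library sigma-algebra (generated by the coordinates) is
   the Borel one; the measure below is the m-fold product of lebesgue_measure,
   as lebesgue_tuple_box confirms. *)
Definition tuple_cons (R : realType) (m : nat)
    (p : m.-tuple R * measurableTypeR R) : m.+1.-tuple R :=
  [tuple of p.2 :: p.1].

Lemma measurable_tuple_cons (R : realType) (m : nat) :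
  measurable_fun [set: m.-tuple R * measurableTypeR R] (@tuple_cons R m).
Proof. exact: measurable_cons. Qed.

Section lebesgue_tuple_step.
Variables (R : realType) (m : nat).
Variable mu : {measure set (m.-tuple R) -> \bar R}.

Definition lebesgue_tuple_step : set (m.+1.-tuple R) -> \bar R :=
  pushforward (mu \x @lebesgue_measure R)%E (@tuple_cons R m).

Let step0 : lebesgue_tuple_step set0 = 0%E.
Proof. by rewrite /lebesgue_tuple_step /pushforward preimage_set0 measure0. Qed.

Let step_ge0 B : (0 <= lebesgue_tuple_step B)%E.
Proof. by apply: integral_ge0 => x _; exact: measure_ge0. Qed.

Let step_sigma_additive : semi_sigma_additive lebesgue_tuple_step.
Proof.
exact: (@measure_semi_sigma_additive _ _ _
  (measure_function_pushforward__canonical__measure_function_Measure _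
     (@measurable_tuple_cons R m))).
Qed.

HB.instance Definition _ := isMeasure.Build _ _ _
  lebesgue_tuple_step step0 step_ge0 step_sigma_additive.

End lebesgue_tuple_step.

Fixpoint lebesgue_tuple (R : realType) (m : nat) :
    {measure set (m.-tuple R) -> \bar R} :=
  match m with
  | 0 => \d_([tuple] : 0.-tuple R)
  | n.+1 => lebesgue_tuple_step (lebesgue_tuple R n)
  end.

Lemma lebesgue_tuple_box (R : realType) (m : nat) (B : 'I_m -> set R) :
  (forall i, measurable (B i)) ->
  lebesgue_tuple R m [set a | forall i, B i (tnth a i)] =
  (\prod_(i < m) @lebesgue_measure R (B i))%E.
Proof.
elim: m B => [|m IH] B mB /=.
  rewrite big_ord0 diracE mem_set//; by case.
rewrite big_ord_recl /lebesgue_tuple_step /pushforward.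
pose C := [set a : m.-tuple R | forall i, B (lift ord0 i) (tnth a i)].
have mC : measurable C.
  rewrite (_ : C = \bigcap_(i in [set: 'I_m])
      (fun a : m.-tuple R => tnth a i) @^-1` B (lift ord0 i)).
    apply: fin_bigcap_measurable => // i _.
    by rewrite -[X in measurable X]setTI; apply: measurable_tnth.
  by apply/seteqP; split => [t Ct i _|t Ct i]; [exact: Ct|exact: (Ct i I)].
rewrite (_ : _ @^-1` _ = C `*` (B ord0 : set (measurableTypeR R))); last first.
  apply/seteqP; split => -[t x] /=.
    move=> H; split => [i|]; last by have := H ord0.
    by have := H (lift ord0 i); rewrite /tuple_cons tnthS.
  move=> [Ct Bx] i; case: (unliftP ord0 i) => [j|] ->; last exact: Bx.
  by rewrite /tuple_cons tnthS; exact: Ct.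
rewrite product_measure1E//; last exact: mB.
by rewrite muleC -(IH (fun i => B (lift ord0 i))).
Qed.

Definition is_maximum (R : realType) (E : set R) (v : R) := E v /\ ubound E v.

Definition is_argmax (R : realType) (T : Type) (D : set T) (J : T -> \bar R)
    (x : T) :=
  D x /\ forall y, D y -> (J y <= J x)%E.

(* F s a z is only meaningful for actions a in the action space. *)
Definition action_value (R : realType) (S : Type) (m d : nat)
    (F : S -> m.-tuple R -> 'cV[R]_d -> 'cV[R]_d)
    (s : S) (a : m.-tuple R) (z : 'cV[R]_d) : R :=
  ((F s a z)^T *m z) ord0 ord0.

Section densities.
Variables (R : realType) (m : nat) (A : set (m.-tuple R)).
Implicit Types p q f : m.-tuple R -> R.
Local Notation leb := (lebesgue_tuple R m).

Definition is_density p :=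
  [/\ measurable_fun A p,
      forall a, A a -> 0 <= p a
    & (\int[leb]_(a in A) (p a)%:E = 1)%E].

Definition density_measure p : set (m.-tuple R) -> \bar R :=
  fun B => (\int[leb]_(a in A `&` B) (p a)%:E)%E.

(* Since ln vanishes on nonpositive reals and x / 0 = 0, the integrand is 0
   where p = 0 (the convention 0 log (0 / q) = 0) and where q = 0 < p, a null
   set under absolute continuity. As p log (p / q) >= p - q elsewhere, its
   negative part is integrable, so the extended integral is well defined. *)
Definition kl_div p q : \bar R :=
  if `[< density_measure p `<< density_measure q >]
  then (\int[leb]_(a in A) (p a * ln (p a / q a))%:E)%E
  else +oo%E.

(* When f <= 0 wherever mu > 0, the integrand is a.e. nonpositive for every
   density with finite divergence to mu, so the extended integral is
   well defined, possibly -oo. *)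
Definition expectation_density p f : \bar R :=
  (\int[leb]_(a in A) (p a * f a)%:E)%E.

Definition kl_feasible mu (eps : R) : set (m.-tuple R -> R) :=
  [set p | is_density p /\ (kl_div p mu <= eps%:E)%E].

Definition is_kl_solution f mu (eps : R) p :=
  is_argmax (kl_feasible mu eps) (expectation_density ^~ f) p.

Definition kl_lagrangian f mu (eps lam : R) p : \bar R :=
  (expectation_density p f - lam%:E * (kl_div p mu - eps%:E))%E.

Definition is_kl_multiplier f mu (eps : R) p (lam : R) :=
  [/\ 0 <= lam,
      is_argmax [set p' | is_density p' /\ (kl_div p' mu < +oo)%E]
        (kl_lagrangian f mu eps lam) p
    & (lam%:E * (kl_div p mu - eps%:E) = 0)%E].

End densities.

(* Main.v *)
Require Import Defs.
From HB Require Import structures.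
From mathcomp Require Import all_boot all_order all_algebra.
From mathcomp Require Import all_classical all_reals all_analysis.
From mathcomp Require Import measurable_realfun ring lra.

Set Implicit Arguments.
Unset Strict Implicit.
Unset Printing Implicit Defensive.

Import Order.TTheory GRing.Theory Num.Theory.
Import numFieldNormedType.Exports.

Local Open Scope classical_set_scope.
Local Open Scope ring_scope.

(* The Gibbs density q = Z^-1 mu exp(alpha f), f = Q - V, is admissible for the
   Lagrangian, with value (ln Z + eps) / alpha. For any other admissible p, the
   value at p falls short of it by D(p || q) / alpha; an optimal p thus has
   D(p || q) <= 0. As D(p || q) is the integral of p ln (p / q) - (p - q), which
   is nonnegative and vanishes only where p = q, optimality forces p = q a.e. *)

(** * The pointwise inequality behind the nonnegativity of relative entropy *)

Section pointwise_gibbs.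
Variable R : realType.
Implicit Types p q : R.

(** For positive [p] and [q] this is exp(t) >= 1 + t at t = ln (q / p), multiplied by [p]. The last
    hypothesis excludes q = 0 < p, where x / 0 = 0 and ln 0 = 0 would make the right-hand side 0. *)
Lemma mulr_ln_div_ge p q : 0 <= p -> 0 <= q -> (q = 0 -> p = 0) ->
  p - q <= p * ln (p / q).
Proof.
rewrite [0 <= p]le_eqVlt => /predU1P[<- q0 _|p0].
  by rewrite mul0r sub0r oppr_le0.
rewrite le_eqVlt => /predU1P[<- /(_ erefl) p_eq0|q0 _].
  by rewrite p_eq0 ltxx in p0.
have := expR_ge1Dx (ln (q / p)).
rewrite lnK ?posrE ?divr_gt0// !ln_div ?posrE// => /(ler_wpM2l (ltW p0)).
by rewrite mulrCA divff ?gt_eqF// mulr1; lra.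
Qed.

(** Equality case of the previous bound: exp(t) > 1 + t unless t = 0, and ln (q / p) = 0 means p =
    q. *)
Lemma mulr_ln_div_eq p q : 0 <= p -> 0 <= q -> (q = 0 -> p = 0) ->
  p * ln (p / q) = p - q -> p = q.
Proof.
rewrite [0 <= p]le_eqVlt => /predU1P[<- q0 _|p0]; first by rewrite mul0r; lra.
rewrite le_eqVlt => /predU1P[<- /(_ erefl) p_eq0|q0 _].
  by rewrite p_eq0 ltxx in p0.
have [/eqP|/expR_gt1Dx] := eqVneq (ln (q / p)) 0.
  rewrite ln_eq0 ?divr_gt0// => /eqP qp _.
  by rewrite -[q](divfK (lt0r_neq0 p0)) qp mul1r.
rewrite lnK ?posrE ?divr_gt0// !ln_div ?posrE// => h.
have := h; rewrite -(ltr_pM2l p0).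
by rewrite mulrCA divff ?gt_eqF// mulr1; lra.
Qed.

End pointwise_gibbs.

(** * Integrability from one-sided bounds *)

Section integral_complements.
Context d (T : measurableType d) (R : realType).
Variables (nu : {measure set T -> \bar R}) (D : set T) (mD : measurable D).

(** On nonnegative reals inversion is the power with exponent -1, even at 0, where both are 0. *)
Lemma measurable_invr_ge0 (f : T -> R) : measurable_fun D f ->
  (forall x, D x -> 0 <= f x) -> measurable_fun D (fun x => (f x)^-1).
Proof.
move=> mf f0; apply: (eq_measurable_fun (fun x => f x `^ (-1))).
  by move=> x; rewrite inE => Dx; rewrite powR_inv1// f0.
exact: measurableT_comp (measurable_powR _) mf.
Qed.

Local Open Scope ereal_scope.

(** The bound by [g] makes the integral of [f^\-] finite; as the integral of [f] is not [+oo], that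
    of [f^\+] is then finite too. *)
Lemma integrable_ae_ge (f g : T -> \bar R) : measurable_fun D f ->
  nu.-integrable D g -> {ae nu, forall x, D x -> g x <= f x} ->
  \int[nu]_(x in D) f x < +oo -> nu.-integrable D f.
Proof.
move=> mf ig gf foo; have mg := measurable_int _ ig.
have fn_fin : \int[nu]_(x in D) f^\- x < +oo.
  apply: le_lt_trans (integral_funeneg_lt_pinfty mD ig).
  apply: ae_ge0_le_integral => //; [exact: measurable_funeneg..|].
  apply: filterS gf => x /[apply] gfx.
  by rewrite !funenegE ge_max !le_max lexx orbT leeN2 gfx.
apply/integrableP; split => //.
rewrite -[fun x => _]/(abse \o f) fune_abse ge0_integralD//; last 2 first.
- exact: measurable_funepos.
- exact: measurable_funeneg.
rewrite lte_add_pinfty//; move: foo fn_fin; rewrite integralE.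
have : 0 <= \int[nu]_(x in D) f^\- x by exact: integral_ge0.
move: (\int[nu]_(x in D) f^\+ x) (\int[nu]_(x in D) f^\- x).
by case=> [a||] [b||] // *; rewrite ltry.
Qed.

(** Mirror image of [integrable_ae_ge]: here [g] controls [f^\+], and the finiteness of [f^\-]
    follows. *)
Lemma integrable_ae_le (f g : T -> \bar R) : measurable_fun D f ->
  nu.-integrable D g -> {ae nu, forall x, D x -> f x <= g x} ->
  -oo < \int[nu]_(x in D) f x -> nu.-integrable D f.
Proof.
move=> mf ig fg foo; have mg := measurable_int _ ig.
have fp_fin : \int[nu]_(x in D) f^\+ x < +oo.
  apply: le_lt_trans (integral_funepos_lt_pinfty mD ig).
  apply: ae_ge0_le_integral => //; [exact: measurable_funepos..|].
  apply: filterS fg => x /[apply] fgx.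
  by rewrite !funeposE ge_max !le_max lexx orbT fgx.
apply/integrableP; split => //.
rewrite -[fun x => _]/(abse \o f) fune_abse ge0_integralD//; last 2 first.
- exact: measurable_funepos.
- exact: measurable_funeneg.
rewrite lte_add_pinfty//; move: foo fp_fin; rewrite integralE.
have : 0 <= \int[nu]_(x in D) f^\+ x by exact: integral_ge0.
move: (\int[nu]_(x in D) f^\+ x) (\int[nu]_(x in D) f^\- x).
by case=> [a||] [b||] // *; rewrite ltry.
Qed.

Lemma ae_ge0_integral_eq0 (f : T -> \bar R) : measurable_fun D f ->
  {ae nu, forall x, D x -> 0 <= f x} -> \int[nu]_(x in D) f x <= 0 ->
  {ae nu, forall x, D x -> f x = 0}.
Proof.
move=> mf f0 intf; apply/(ae_eq_integral_abs _ mD mf)/eqP.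
rewrite eq_le integral_ge0 ?andbT//; apply: le_trans intf.
rewrite (@ae_eq_integral _ _ _ _ _ f)//; first exact: measurableT_comp.
by apply: filterS f0 => x /[apply] /gee0_abs.
Qed.

End integral_complements.

(** * Absolute continuity and integrability of the divergence integrand *)

Section kl_divergence.
Variables (R : realType) (m : nat) (A : set (m.-tuple R)) (mA : measurable A).
Local Notation leb := (lebesgue_tuple R m).
Implicit Types p q : m.-tuple R -> R.

Lemma integrable_density p : is_density A p -> leb.-integrable A (EFin \o p).
Proof.
move=> [mp p0 p1]; apply/integrableP; split; first exact/measurable_EFinP.
rewrite (eq_integral (fun a => (p a)%:E)) ?p1 ?ltry// => a; rewrite inE => Aa.
by rewrite /= ger0_norm// p0.
Qed.

Lemma ae_eq0_density_measure p B : measurable B -> is_density A p ->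
  density_measure A p B = 0%E -> {ae leb, forall a, (A `&` B) a -> p a = 0}.
Proof.
move=> mB [mp p0 _] pB; have mAB : measurable (A `&` B) by exact: measurableI.
have mpB : measurable_fun (A `&` B) (EFin \o p).
  by apply/measurable_EFinP; exact: measurable_funS mp.
suff : {ae leb, forall a, (A `&` B) a -> (EFin \o p) a = 0%E}.
  by apply: filterS => a /[apply] -[].
apply: ae_ge0_integral_eq0 => //; last by rewrite -[leRHS]pB.
by apply: aeW => a [Aa _]; rewrite lee_fin p0.
Qed.

Lemma kl_div_lty_dominates p q :
  (kl_div A p q < +oo)%E -> density_measure A p `<< density_measure A q.
Proof. by rewrite /kl_div; case: asboolP. Qed.

Lemma kl_divE p q : density_measure A p `<< density_measure A q ->
  kl_div A p q = (\int[leb]_(a in A) (p a * ln (p a / q a))%:E)%E.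
Proof. by move=> pq; rewrite /kl_div asboolT. Qed.

(** The zero set of [q] in [A] has measure 0 under the density [q], hence under [p], so [p] vanishes
    a.e. on it. *)
Lemma dominates_ae_eq0 p q : is_density A p -> is_density A q ->
  density_measure A p `<< density_measure A q ->
  {ae leb, forall a, A a -> q a = 0 -> p a = 0}.
Proof.
move=> dp dq pq; have [mq _ _] := dq.
pose N := A `&` q @^-1` [set 0].
have mN : measurable N by exact: mq.
suff /(ae_eq0_density_measure mN dp) : density_measure A p N = 0%E.
  by apply: filterS => a pN Aa qa0; apply: pN.
(* Nullity of [N] is tested on all its measurable subsets [B], and [q] is 0 on each of them. *)
apply: (pq N) => // B _ BN; apply: integral0_eq => a [_ /BN[_ /= ->]].
by [].
Qed.

Lemma measurable_kl_integrand p q : is_density A p -> is_density A q ->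
  measurable_fun A (fun a => p a * ln (p a / q a)).
Proof.
move=> [mp _ _] [mq q0 _]; apply: measurable_funM => //.
apply: (measurableT_comp (@measurable_ln R)).
by apply: measurable_funM => //; exact: measurable_invr_ge0.
Qed.

(** The integrand is a.e. at least [p - q], which is integrable, and a finite divergence bounds its
    integral from above. *)
Lemma integrable_kl_integrand p q : is_density A p -> is_density A q ->
  (kl_div A p q < +oo)%E ->
  leb.-integrable A (fun a => (p a * ln (p a / q a))%:E).
Proof.
move=> dp dq kloo; have pq := kl_div_lty_dominates kloo.
apply: (@integrable_ae_ge _ _ _ _ _ mA _ ((EFin \o p) \- (EFin \o q))%E).
- by apply/measurable_EFinP; exact: measurable_kl_integrand.
- by apply: integrableB => //; exact: integrable_density.
- apply: filterS (dominates_ae_eq0 dp dq pq) => a pqa Aa.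
  have [[_ p0 _] [_ q0 _]] := (dp, dq).
  by rewrite /= lee_fin mulr_ln_div_ge ?p0 ?q0//; exact: pqa.
- by rewrite -kl_divE.
Qed.

End kl_divergence.

(** * The Gibbs density: normalization, divergence and optimality *)

Section gibbs_density.
Variables (R : realType) (m : nat) (A : set (m.-tuple R)) (mA : measurable A).
Local Notation leb := (lebesgue_tuple R m).
Variables (f mu : m.-tuple R -> R) (alpha : R).
Hypotheses (mf : measurable_fun A f) (dmu : is_density A mu).
Hypothesis f_le0 : forall a, A a -> 0 < mu a -> f a <= 0.
Hypothesis alpha_gt0 : 0 < alpha.

Let mu_ge0 a : A a -> 0 <= mu a. Proof. by case: dmu => _ + _; exact. Qed.

Definition gibbs_weight a := mu a * expR (alpha * f a).
(** [fine] loses no information, since the weight is bounded by the integrable [mu]. *)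
Definition partition_function : R :=
  fine (\int[leb]_(a in A) (gibbs_weight a)%:E).
Definition gibbs_density a := partition_function^-1 * gibbs_weight a.
Local Notation w := gibbs_weight.
Local Notation Z := partition_function.
Local Notation q := gibbs_density.

Let w_ge0 a : A a -> 0 <= w a.
Proof. by move=> Aa; rewrite mulr_ge0 ?expR_ge0// mu_ge0. Qed.

Let mw : measurable_fun A w.
Proof.
case: dmu => mmu _ _; apply: measurable_funM => //.
apply: (measurableT_comp (@measurable_expR R)).
exact: measurable_funM.
Qed.

Lemma gibbs_weight_eq0 a : (w a == 0) = (mu a == 0).
Proof. by rewrite mulf_eq0 [expR _ == 0]gt_eqF ?expR_gt0// orbF. Qed.

(** Where [mu] is positive, [f <= 0] makes the exponential at most 1; elsewhere both sides are 0. *)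
Lemma gibbs_weight_le a : A a -> w a <= mu a.
Proof.
move=> Aa; have := mu_ge0 Aa; rewrite le_eqVlt => /predU1P[mu0|mu_gt0].
  by rewrite /w -mu0 mul0r.
rewrite ler_piMr ?(ltW mu_gt0)// -expR0 ler_expR.
by rewrite pmulr_rle0// f_le0.
Qed.

Let integrable_w : leb.-integrable A (EFin \o w).
Proof.
apply: (@le_integrable _ _ _ leb _ mA _ (EFin \o mu)) => //.
- exact/measurable_EFinP.
- move=> a Aa; rewrite lee_fin !ger0_norm ?w_ge0 ?mu_ge0//.
  exact: gibbs_weight_le.
- exact: integrable_density.
Qed.

Lemma integral_gibbs_weight : (\int[leb]_(a in A) (w a)%:E)%E = Z%:E.
Proof. by rewrite fineK//; exact: integrable_fin_num integrable_w. Qed.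

(** If [Z] were 0, the weight, and with it [mu], would vanish a.e., against the total mass 1 of
    [mu]. *)
Lemma partition_function_gt0 : 0 < Z.
Proof.
rewrite lt_neqAle -lee_fin -integral_gibbs_weight.
apply/andP; split; last first.
  by apply: integral_ge0 => a Aa; rewrite lee_fin w_ge0.
apply/eqP => Z0.
have w_eq0 : {ae leb, forall a, A a -> (w a)%:E = 0%E}.
  apply: ae_ge0_integral_eq0 => //.
  - exact/measurable_EFinP.
  - by apply: aeW => a Aa; rewrite lee_fin w_ge0.
  - by rewrite integral_gibbs_weight -Z0.
have : (\int[leb]_(a in A) (mu a)%:E = 0)%E.
  rewrite (@ae_eq_integral _ _ _ _ _ (cst 0%E)) ?integral0//.
    by apply/measurable_EFinP; case: dmu.
  apply: filterS w_eq0 => a /[apply] -[] /eqP.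
  by rewrite gibbs_weight_eq0 => /eqP ->.
by case: dmu => _ _ -> /eqP; rewrite eqe oner_eq0.
Qed.

Lemma gibbs_density_ge0 a : A a -> 0 <= q a.
Proof.
by move=> Aa; rewrite mulr_ge0 ?w_ge0// invr_ge0 ltW ?partition_function_gt0.
Qed.

Lemma is_density_gibbs : is_density A q.
Proof.
split; [exact: measurable_funM|exact: gibbs_density_ge0|].
under eq_integral do rewrite EFinM.
rewrite integralZl// integral_gibbs_weight -EFinM mulVf// gt_eqF//.
exact: partition_function_gt0.
Qed.

Lemma gibbs_density_eq0 a : (q a == 0) = (mu a == 0).
Proof.
by rewrite mulf_eq0 invr_eq0 gt_eqF ?partition_function_gt0//= gibbs_weight_eq0.
Qed.

(* x exp(-x) <= 1 bounds the integrand, even though f may be unbounded. *)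
Lemma integrable_gibbs_density_mul :
  leb.-integrable A (fun a => (q a * f a)%:E).
Proof.
apply: (@le_integrable _ _ _ _ _ mA _
    (fun a => ((Z^-1 * alpha^-1)%:E * (EFin \o mu) a)%E)).
- apply/measurable_EFinP; apply: measurable_funM => //.
  by case: is_density_gibbs.
- move=> a Aa /=; rewrite lee_fin.
  have Zi : 0 <= Z^-1 by rewrite invr_ge0 ltW// partition_function_gt0.
  have ai : 0 < alpha^-1 by rewrite invr_gt0.
  rewrite [leRHS]ger0_norm; last by rewrite !mulr_ge0 ?mu_ge0// ltW.
  have := mu_ge0 Aa; rewrite le_eqVlt => /predU1P[mu0|mu_gt0].
    by rewrite /q /w -mu0 !mul0r mulr0 mul0r normr0 mulr0.
  rewrite normrM ger0_norm ?gibbs_density_ge0// ler0_norm ?f_le0//.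
  rewrite /q /w -!mulrA ler_wpM2l// [alpha^-1 * _]mulrC ler_wpM2l ?mu_ge0//.
  rewrite -(ler_pM2l alpha_gt0) mulfV ?gt_eqF// mulrCA mulrN.
  rewrite -ler_pdivlMl ?expR_gt0//.
  by rewrite mulr1 -expRN; have := expR_ge1Dx (- (alpha * f a)); lra.
- by apply: integrableZl => //; exact: integrable_density.
Qed.

(** [q] and [mu] have the same zeros, because the exponential and [Z] are positive. *)
Lemma gibbs_density_dominates :
  density_measure A q `<< density_measure A mu.
Proof.
move=> N muN B mB BN; have muB := muN B mB BN.
have mAB := measurableI _ _ mA mB.
rewrite /density_measure (@ae_eq_integral _ _ _ _ _ (cst 0%E)) ?integral0//.
  apply/measurable_EFinP; case: is_density_gibbs => mq _ _.
  exact: measurable_funS mq.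
apply: filterS (ae_eq0_density_measure mA mB dmu muB) => a /[apply] /eqP.
by rewrite -gibbs_density_eq0 => /eqP ->.
Qed.

(** Comes from ln q = ln mu + alpha f - ln Z. Integrated, it reads D(p || q) = D(p || mu) - alpha
    E_p[f] + ln Z. *)
Lemma mulr_ln_gibbs_ratio p a : A a -> 0 <= p -> (mu a = 0 -> p = 0) ->
  p * ln (p / q a) = p * ln (p / mu a) - alpha * (p * f a) + ln Z * p.
Proof.
move=> Aa; rewrite le_eqVlt => /predU1P[<- _|p0].
  by rewrite !(mul0r, mulr0); lra.
have := mu_ge0 Aa; rewrite le_eqVlt => /predU1P[<- /(_ erefl) p_eq0|mu0 _].
  by rewrite p_eq0 ltxx in p0.
have Z0 := partition_function_gt0; have e0 := expR_gt0 (alpha * f a).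
rewrite !ln_div ?posrE// ?mulr_gt0 ?invr_gt0//.
rewrite !lnM ?posrE ?mulr_gt0 ?invr_gt0//.
by rewrite lnV ?posrE// expRK; lra.
Qed.

(** Take p = q in the preceding identity: its left-hand side is 0, which leaves q ln (q / mu) =
    alpha q f - q ln Z. *)
Lemma kl_gibbs_density (e : R) :
  (\int[leb]_(a in A) (q a * f a)%:E)%E = e%:E ->
  kl_div A q mu = (alpha * e - ln Z)%:E.
Proof.
move=> eE; rewrite kl_divE; last exact: gibbs_density_dominates.
have dq := is_density_gibbs; have [mq q0 q1] := dq.
have iqf := integrable_gibbs_density_mul; have iq := integrable_density dq.
transitivity (\int[leb]_(a in A)
    (alpha%:E * (q a * f a)%:E - (ln Z)%:E * (q a)%:E))%E.
  apply: eq_integral => a; rewrite inE => Aa; congr EFin.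
  have := @mulr_ln_gibbs_ratio (q a) a Aa (q0 _ Aa).
  (* Zeros of [q] are treated apart, since there [q a / q a] is 0 instead of 1. *)
  have [qa0 _|qa0] := eqVneq (q a) 0.
    by rewrite qa0 !(mul0r, mulr0) subrr.
  rewrite divff// ln1 mulr0 => ratioE.
  suff /ratioE : mu a = 0 -> q a = 0 by lra.
  by move/eqP; rewrite -gibbs_density_eq0 => /eqP.
rewrite integralB//; [|exact: integrableZl..].
by rewrite !integralZl// eE q1 mule1.
Qed.

(** The expectation [e] cancels against its multiple by [alpha] in the divergence, scaled back by
    [alpha^-1]. *)
Lemma kl_lagrangian_gibbs (eps : R) :
  kl_lagrangian A f mu eps alpha^-1 q = (alpha^-1 * (ln Z + eps))%:E.
Proof.
have /fineK := integrable_fin_num mA integrable_gibbs_density_mul.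
set e := fine _ => eE.
rewrite /kl_lagrangian (kl_gibbs_density (esym eE)) /expectation_density -eE.
transitivity (e - alpha^-1 * (alpha * e - ln Z - eps))%:E; first by [].
congr EFin; by field; rewrite gt_eqF.
Qed.

Lemma kl_lagrangian_argmax (eps : R) p : is_density A p ->
  (kl_div A p mu < +oo)%E ->
  (kl_lagrangian A f mu eps alpha^-1 q <=
   kl_lagrangian A f mu eps alpha^-1 p)%E ->
  {ae leb, forall a, A a -> p a = q a}.
Proof.
move=> dp kloo; have [mp p0 p1] := dp.
have dq := is_density_gibbs; have [mq q0 q1] := dq.
have pmu := dominates_ae_eq0 mA dp dmu (kl_div_lty_dominates kloo).
have ik := integrable_kl_integrand mA dp dmu kloo.
have /fineK := integrable_fin_num mA ik.
rewrite -(kl_divE (kl_div_lty_dominates kloo)); set k := fine _ => kE.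
rewrite kl_lagrangian_gibbs /kl_lagrangian -kE.
rewrite -[(alpha^-1%:E * _)%E]/((alpha^-1 * (k - eps))%:E) => Lpq.
(* [p f] is a.e. nonpositive, and its integral is not [-oo] because the Lagrangian at [p] is at
   least the finite value at [q]. *)
have ipf : leb.-integrable A (fun a => (p a * f a)%:E).
  apply: (@integrable_ae_le _ _ _ _ _ mA _ (cst 0%E)).
  - by apply/measurable_EFinP; exact: measurable_funM.
  - exact: integrable0.
  - apply: filterS pmu => a pmua Aa; rewrite lee_fin.
    have := mu_ge0 Aa; rewrite le_eqVlt => /predU1P[mu0|mu0].
      by rewrite pmua// mul0r.
    by rewrite mulr_ge0_le0 ?p0// f_le0.
  - move: Lpq; rewrite /expectation_density.
    by move: (integral _ _ _) => [x||]//; rewrite ?ltNyr.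
have /fineK := integrable_fin_num mA ipf; set x := fine _ => xE.
move: Lpq; rewrite /expectation_density -xE -EFinB lee_fin => Lpq.
(* The left-hand side is D(p || q); the bound is [Lpq] multiplied by [alpha]. *)
have gap : k - alpha * x + ln Z <= 0.
  move: Lpq; rewrite -(ler_pM2l alpha_gt0).
  by rewrite mulrBr !mulrA mulfV ?gt_eqF//; lra.
(* [h] is the nonnegative function p ln (p / q) - (p - q), expanded into terms already known to be
   integrable so that its integral splits. Both densities have mass 1, so subtracting [p - q] leaves
   the integral equal to D(p || q). *)
pose h a :=
  (p a * ln (p a / mu a) - alpha * (p a * f a) + ln Z * p a) - (p a - q a).
have hE a : A a -> (mu a = 0 -> p a = 0) ->
    h a = p a * ln (p a / q a) - (p a - q a).
  by move=> Aa pmua; rewrite mulr_ln_gibbs_ratio// p0.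
have qp a : (mu a = 0 -> p a = 0) -> q a = 0 -> p a = 0.
  by move=> pmua /eqP; rewrite gibbs_density_eq0 => /eqP.
have ip := integrable_density dp; have iq := integrable_density dq.
have ih1 := integrableB mA ik (integrableZl mA alpha ipf).
have ih2 := integrableD mA ih1 (integrableZl mA (ln Z) ip).
have ih3 := integrableB mA ip iq.
have mh : measurable_fun A (EFin \o h).
  exact: measurable_int _ (integrableB mA ih2 ih3).
have inth : (\int[leb]_(a in A) (EFin \o h) a <= 0)%E.
  rewrite (integralB mA ih2 ih3) (integralB mA ip iq).
  rewrite (integralD mA ih1 (integrableZl mA (ln Z) ip)).
  rewrite (integralB mA ik (integrableZl mA alpha ipf)) !integralZl//.
  rewrite -(kl_divE (kl_div_lty_dominates kloo)) p1 q1 -kE -xE mule1.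
  rewrite -[leLHS]/((k - alpha * x + ln Z - (1 - 1))%:E) lee_fin.
  by move: gap; lra.
have : {ae leb, forall a, A a -> (EFin \o h) a = 0%E}.
  apply: ae_ge0_integral_eq0 => //; apply: filterS pmu => a pmua Aa.
  have {}pmua := pmua Aa.
  rewrite lee_fin hE// subr_ge0 mulr_ln_div_ge ?p0 ?q0//; exact: qp.
apply: filterS2 pmu => a pmua h0 Aa; have {}pmua := pmua Aa.
apply: mulr_ln_div_eq; rewrite ?p0 ?q0//; first exact: qp.
by have [] := h0 Aa; rewrite hE// => /eqP; rewrite subr_eq0 => /eqP.
Qed.

End gibbs_density.

Theorem proposition1 (R : realType) (S : Type) (m d : nat)
    (A : set (m.-tuple R)) (mA : measurable A)
    (F : S -> m.-tuple R -> 'cV[R]_d -> 'cV[R]_d)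
    (mu : S -> m.-tuple R -> R)
    (V : S -> 'cV[R]_d -> R)
    (s : S) (z : 'cV[R]_d)
    (mQ : measurable_fun A (fun a => action_value F s a z))
    (mu_density : is_density A (mu s))
    (V_max : is_maximum
      [set action_value F s a z | a in A `&` [set a | 0 < mu s a]] (V s z))
    (eps : R) (eps_gt0 : 0 < eps)
    (pi_star : S -> m.-tuple R -> R)
    (pi_star_sol : is_kl_solution A (fun a => action_value F s a z - V s z)
      (mu s) eps (pi_star s))
    (alpha : R) (alpha_gt0 : 0 < alpha)
    (alpha_mult : is_kl_multiplier A (fun a => action_value F s a z - V s z)
      (mu s) eps (pi_star s) (1 / alpha)) :
  exists2 c : R, 0 < c &
    {ae lebesgue_tuple R m, forall a, A a ->
      pi_star s a =
        c * (mu s a * expR (alpha * (action_value F s a z - V s z)))}.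
Proof.
(* [V s z] bounds the action values on the support of [mu s], so the advantage is nonpositive
   there. *)
have f_le0 a : A a -> 0 < mu s a -> action_value F s a z - V s z <= 0.
  by move=> Aa mu_gt0; rewrite subr_le0; apply: V_max.2; exists a.
have mf := measurable_funB mQ (measurable_cst (V s z)).
move: alpha_mult; rewrite div1r => -[_ [[dp kloo] argmax] _].
have Z0 := partition_function_gt0 mA mf mu_density f_le0 alpha_gt0.
exists (partition_function A (fun a => action_value F s a z - V s z)
    (mu s) alpha)^-1; first by rewrite invr_gt0.
apply: (kl_lagrangian_argmax mA mf mu_density f_le0 alpha_gt0 dp kloo
  (eps := eps)).
(* The Gibbs density is a legitimate competitor of [pi_star s]: its divergence to [mu s] is a real
   number, by [kl_gibbs_density]. *)
apply: argmax; split; first exact: is_density_gibbs.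
have /fineK eE := integrable_fin_num mA
  (integrable_gibbs_density_mul mA mf mu_density f_le0 alpha_gt0).
by rewrite (kl_gibbs_density mA mf mu_density f_le0 alpha_gt0 (esym eE)) ltry.
Qed.
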